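(* Let $P$ be a connected finite $T_0$ space. Then $\mathcal{CC}_n(P) = TC_n(P)$ for every integer $n\geq 2$.
   Context: **Higher topological complexity.** For a space $X$, let $I=[0,1]$ and let $PX = X^I$ be the free path space. For $n\ge 2$ let $e'_n : PX \to X^n$, $e'_n(\alpha) = (\alpha(0), \alpha(\tfrac{1}{n-1}), \alpha(\tfrac{2}{n-1}), \ldots, \alpha(1))$. $TC_n(X)$ is the Schwarz genus of $e'_n$: the least $r$ such that $X^n$ is a union of $r$ open subsets $U_1,\dots,U_r$ on each of which there is a continuous map $s_i: U_i\to PX$ with $e'_n\circ s_i = \mathrm{Id}_{U_i}$ (and $\infty$ if there is no such $r$). **Finite spaces.** A finite space is a finite $T_0$ topological space; all finite spaces are assumed connected. A finite space $P$ is identified with a finite poset: $x\le y$ iff $U_x\subseteq U_y$, where $U_x$ is the intersection of all open sets containing $x$; conversely $U_x=\{y: y\le x\}$, so open sets are the down-closed sets. Continuous maps between finite spaces are exactly order-preserving maps. $P^n$ has the product (coordinatewise) order. **Higher combinatorial complexity.** For $n\ge2$, $m\ge0$, $J_{n,m}$ is the poset on the $nm+1$ points $\{0\}\cup\{i_j : 1\le i\le m,\ 1\le j\le n\}$ (where $i_j$ denotes the $i$-th point of the $j$-th branch) with order given by the $n$ zigzags $0\le 1_j\ge 2_j\le\cdots\ge(\le)\, m_j$, $j=1,\dots,n$ (for $m=0$ it is a single point, and $m_j$ means $0$). $P^{J_{n,m}}$ is the finite space of all order-preserving maps $J_{n,m}\to P$ with pointwise order, and $q_{n,m}:P^{J_{n,m}}\to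 P^n$, $q_{n,m}(\gamma)=(\gamma(m_1),\gamma(m_2),\dots,\gamma(m_n))$. $\mathcal{CC}_{n,m}(P)$ is the smallest positive integer $r$ such that $P^n$ is covered by $r$ open sets $Q_1,\dots,Q_r$ with continuous (order-preserving) sections $s_i:Q_i\to P^{J_{n,m}}$ of $q_{n,m}$ for each $i$ ($\infty$ if there is no such $r$). $\mathcal{CC}_n(P)=\min_{m\ge1}\mathcal{CC}_{n,m}(P)$. *)

(* Defs.v *)
From HB Require Import structures.
From mathcomp Require Import all_boot all_order all_algebra.
From mathcomp Require Import all_classical all_reals topology ereal normedtype.

Set Implicit Arguments.
Unset Strict Implicit.
Unset Printing Implicit Defensive.

Import Order.TTheory GRing.Theory Num.Theory.
Import numFieldNormedType.Exports.

Local Open Scope classical_set_scope.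
Local Open Scope ring_scope.

(* Every nonempty set of naturals has a minimum, so this infimum is attained;
   the infimum of the empty set is +oo. *)
Definition least (R : realType) (S : set nat) : \bar R :=
  ereal_inf [set (r%:R)%:E | r in S].

Notation power X n := (prod_topology (fun _ : 'I_n => X)).

Definition unit_interval (R : realType) : Type := set_type `[0%R : R, 1%R].
HB.instance Definition _ (R : realType) :=
  Topological.copy (unit_interval R) (set_type `[0%R : R, 1%R]).

(* Continuous paths, with the compact-open topology; this topology is carried
   by the type of all functions, hence the initial topology for the inclusion. *)
Definition path_space (R : realType) (X : topologicalType) : Type :=
  continuousType (unit_interval R) X.
HB.instance Definition _ (R : realType) (X : topologicalType) :=
  Topological.copy (path_space R X)
    (initial_topology
      (fun a : continuousType (unit_interval R) X =>
         (a : unit_interval R -> X) : {compact-open, unit_interval R -> X})).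

Lemma node_subproof (R : realType) (n : nat) (i : 'I_n) :
  (i%:R / n.-1%:R : R) \in `[0%R : R, 1%R]%classic.
Proof.
rewrite inE /= in_itv /= divr_ge0 ?ler0n //=.
have [->|n1] := eqVneq n.-1 0%N; first by rewrite invr0 mulr0 ler01.
rewrite ler_pdivrMr ?ltr0n ?lt0n // mul1r ler_nat.
by case: n i n1 => [[]//|n] i _; rewrite -ltnS.
Qed.

Definition node (R : realType) (n : nat) (i : 'I_n) : unit_interval R :=
  exist _ (i%:R / n.-1%:R) (node_subproof R i).

Definition path_eval (R : realType) (X : topologicalType) (n : nat)
    (a : path_space R X) : power X n :=
  fun i => (a : continuousType (unit_interval R) X) (node R i).

Definition has_local_section (E B : topologicalType) (p : E -> B) (U : set B) :=
  exists2 s : U -> E, continuous s & forall x : U, p (s x) = set_val x.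

(* r > 0 is automatic unless B is empty. *)
Definition schwarz_genus (R : realType) (E B : topologicalType) (p : E -> B) :
    \bar R :=
  least R [set r | (0 < r)%N /\
    exists U : 'I_r -> set B,
      [/\ forall i, open (U i),
          \bigcup_i U i = [set: B] &
          forall i, has_local_section p (U i)]].

Definition TC (R : realType) (n : nat) (X : topologicalType) : \bar R :=
  schwarz_genus R (@path_eval R X n).

Definition min_open (P : topologicalType) (x : P) : set P :=
  \bigcap_(U in [set U : set P | open U /\ U x]) U.

Definition spec_le (P : topologicalType) (x y : P) : Prop :=
  min_open x `<=` min_open y.

(* [None] is the point 0, and [Some (j, i)] is the point (i+1)_(j+1): branches
   and positions are numbered from 1 on paper and from 0 in ordinals. *)
Definition fence (n m : nat) : Type := option ('I_n * 'I_m).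

HB.instance Definition _ n m := Finite.copy (fence n m) (option ('I_n * 'I_m)).

Definition level n m (a : fence n m) : nat :=
  if a is Some (_, i) then i.+1 else 0%N.

Definition same_branch n m (a b : fence n m) : bool :=
  if (a, b) is (Some (j, _), Some (k, _)) then j == k else true.

(* Points of even level are minimal and points of odd level are maximal, so the
   zigzags already form a transitive relation. *)
Definition fence_le n m (a b : fence n m) : bool :=
  (a == b) ||
  [&& same_branch a b, ~~ odd (level a) &
      (level b == (level a).+1) || (level a == (level b).+1)].

Lemma fence_le_odd n m (a b : fence n m) :
  fence_le a b -> a = b \/ ~~ odd (level a) /\ odd (level b).
Proof.
case/orP => [/eqP|/and3P[_ ea /orP[]/eqP e]]; first by left.
  by right; rewrite e.
by right; split=> //; move: ea; rewrite e /= negbK.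
Qed.

Lemma fence_le_refl n m : reflexive (@fence_le n m).
Proof. by move=> a; rewrite /fence_le eqxx. Qed.

Lemma fence_le_anti n m : antisymmetric (@fence_le n m).
Proof.
move=> a b /andP[/fence_le_odd[//|[_ ob]] /fence_le_odd[//|[eb _]]].
by move: eb; rewrite ob.
Qed.

Lemma fence_le_trans n m : transitive (@fence_le n m).
Proof.
move=> b a c ab bc.
have [->//|[_ ob]] := fence_le_odd ab.
have [<-//|[eb _]] := fence_le_odd bc.
by move: eb; rewrite ob.
Qed.

Fact fence_display : Order.disp_t. Proof. exact: Order.Disp tt tt. Qed.

HB.instance Definition _ n m :=
  Order.Le_isPOrder.Build fence_display (fence n m)
    (@fence_le_refl n m) (@fence_le_anti n m) (@fence_le_trans n m).

(* The point m_j, which is 0 when m = 0. *)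
Definition fence_end (n m : nat) : 'I_n -> fence n m :=
  match m return 'I_n -> fence n m with
  | 0 => fun _ => None
  | m'.+1 => fun j => Some (j, ord_max)
  end.

Definition fence_maps (n m : nat) (P : topologicalType) : set (fence n m -> P) :=
  [set g | forall a b : fence n m, (a <= b)%O -> spec_le (g a) (g b)].
Arguments fence_maps : clear implicits.

Definition fence_eval (n m : nat) (P : topologicalType)
    (g : fence_maps n m P) : power P n :=
  fun j => set_val g (fence_end m j).

(* Sections are order-preserving for the coordinatewise order on the domain and
   the pointwise order on the codomain. *)
Definition has_monotone_section (n m : nat) (P : topologicalType)
    (Q : set (power P n)) :=
  exists2 s : Q -> fence_maps n m P,
    (forall x y : Q, (forall j, spec_le (set_val x j) (set_val y j)) ->
       forall a, spec_le (set_val (s x) a) (set_val (s y) a)) &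
    forall x : Q, fence_eval (s x) = set_val x.

Definition CCm (R : realType) (n m : nat) (P : topologicalType) : \bar R :=
  least R [set r | (0 < r)%N /\
    exists Q : 'I_r -> set (power P n),
      [/\ forall i, open (Q i),
          \bigcup_i Q i = [set: power P n] &
          forall i, has_monotone_section m (Q i)]].

(* The minimum over m >= 1 is attained, the values being naturals or +oo. *)
Definition CC (R : realType) (n : nat) (P : topologicalType) : \bar R :=
  ereal_inf [set CCm R n m P | m in [set m | (1 <= m)%N]].

(* Main.v *)
Require Import Defs.
From mathcomp Require Import all_boot all_order all_algebra.
From mathcomp Require Import all_classical all_reals topology ereal normedtype.
From mathcomp Require Import lra.

(* An open U in P^n carries a continuous section of path_eval iff it carries a
   monotone section into P^(J_(n,m)) for some m, and then for arbitrarily large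
   m of a shape that depends on n only, so that finitely many U's can share m.
   From combinatorial to topological: there is a path in the finite space
   J_(n,m) through the ends of all branches, at the times prescribed by
   path_eval; compose the fences s(x) with it.
   Conversely, write a_x for the path s(x). As P^n is finite, every time u has a
   neighbourhood V such that a_x(t) <= a_x(u) for all t in V and all x in U at
   once; a Lebesgue number of this cover gives a uniform subdivision t_0 < t_1 <
   ... of [0,1] and times u_k with a_x(t_k) <= a_x(u_k) >= a_x(t_(k+1)). Branch j
   of the fence of x follows this zigzag from time 0 up to time j/(n-1), and
   stays there. *)

Set Implicit Arguments.
Unset Strict Implicit.
Unset Printing Implicit Defensive.

Import Order.TTheory GRing.Theory Num.Theory.
Import numFieldNormedType.Exports.

Local Open Scope classical_set_scope.
Local Open Scope ring_scope.

(** * The specialization preorder and continuity *)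

Section SpecializationOrder.
Variable P : topologicalType.
Implicit Types (x y : P) (U : set P).

Lemma spec_leP x y : spec_le x y <-> forall U, open U -> U y -> U x.
Proof.
split=> [xy U oU Uy|xy z xz U [oU Uy]]; last first.
  by apply: xz; split=> //; exact: xy.
have /xy/(_ U) : min_open x x by move=> V [].
exact.
Qed.

Lemma spec_le_continuous (T : topologicalType) (g : T -> P) :
  (forall t, \forall t' \near t, spec_le (g t') (g t)) -> continuous g.
Proof.
move=> gle t U; rewrite nbhsE => -[V [oV Vgt] VU].
apply: filterS (gle t) => t' /spec_leP le.
by apply: VU; exact: le.
Qed.

(** Each of the finitely many points not below [y] is missed by some open set around [y]; these sets
    are intersected. *)
Lemma near_spec_le y : finite_set [set: P] -> \forall x \near y, spec_le x y.
Proof.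
move=> /finite_seqP[s Ps].
have Pin x : x \in s by have : [set: P] x by []; rewrite Ps.
have : \forall x \near y, forall i : 'I_(size s),
    x = tnth (in_tuple s) i -> spec_le (tnth (in_tuple s) i) y.
  apply: filter_forall => i; set z := tnth _ _.
  have [zy|/spec_leP] := pselect (spec_le z y); first by near=> x.
  move=> /existsNP[U /not_implyP[oU /not_implyP[Uy Uz]]].
  have : nbhs y U by apply: open_nbhs_nbhs.
  by apply: filterS => x Ux xz; case: Uz; rewrite -xz.
apply: filterS => x le; have /tnthP[i xi] : x \in in_tuple s := Pin x.
by rewrite xi; exact: le.
Unshelve. all: by end_near. Qed.

End SpecializationOrder.

(** * A path through the ends of all branches of the fence *)

Section FencePath.
Variables (R : realType) (n m : nat).

(* How far along branch [j] the path is at time [t]: a tent over the [j]-th node.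
   It is positive for at most one [j] at a time. *)
Let height (j : 'I_n) (t : R) : R := m%:R * (1 - 2 * `|t * n.-1%:R - j%:R|).

(* Maximal points of the fence are closed, so a single height is mapped to each
   of them; minimal points are open and receive the open gaps in between. *)
Let over (a : 'I_n * 'I_m) (t : R) : bool :=
  let: (j, i) := a in
  if odd i.+1 then height j t == i.+1%:R else i%:R < height j t < i%:R + 2.

Definition to_fence (t : R) : fence n m := [pick a | over a t].

(** Scaling by [n.-1] turns the nodes into distinct integers, and a tent is positive only within
    distance 1/2 of its integer. *)
Let height_inj t j k : 0 < height j t -> 0 < height k t -> j = k.
Proof.
rewrite /height => hj hk; apply: val_inj => /=.
have [m0|m0] := posnP m; first by move: hj; rewrite m0 mul0r ltxx.
move: hj hk; rewrite !pmulr_rgt0 ?ltr0n //.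
set T := t * _ => hj hk.
have : `|j%:R - k%:R : R| < 1.
  have -> : j%:R - k%:R = (T - k%:R) - (T - j%:R) :> R by lra.
  by apply: le_lt_trans (ler_normB _ _) _; lra.
rewrite ltr_norml => /andP[h1 h2].
have lejk (p q : nat) : p%:R < q%:R + 1 :> R -> (p <= q)%N.
  by rewrite -ltnS -(ltr_nat R) -[q.+1]addn1 natrD.
by apply/eqP; rewrite eqn_leq !lejk //; lra.
Qed.

Let over_gt0 j i t : over (j, i) t -> 0 < height j t.
Proof.
rewrite /over; case: ifP => [_ /eqP->|_ /andP[+ _]]; first by rewrite ltr0n.
by apply: le_lt_trans; rewrite ler0n.
Qed.

Let over_inj t a b : over a t -> over b t -> a = b.
Proof.
case: a b => [j i] [k l] ha hb.
have jk := height_inj (over_gt0 ha) (over_gt0 hb).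
case: k / jk hb; move: ha; rewrite /over.
set h := height _ _ => hi hl; congr pair; apply: val_inj => /=.
have near_lev (p : nat) :
    (if odd p.+1 then h == p.+1%:R else p%:R < h < p%:R + 2) ->
    p%:R < h < p%:R + 2.
  by case: ifP => // _ /eqP->; rewrite -addn1 natrD; apply/andP; split; lra.
have /andP[i1 i2] := near_lev _ hi; have /andP[l1 l2] := near_lev _ hl.
have il : (i < l.+2)%N by rewrite -(ltr_nat R) -addn2 natrD; lra.
have li : (l < i.+2)%N by rewrite -(ltr_nat R) -addn2 natrD; lra.
(* Of two consecutive levels one is odd; it pins [h] to an excluded endpoint of the open interval of
   the other. *)
have lev_lt (p q : nat) : q = p.+1 ->
    (if odd p.+1 then h == p.+1%:R else p%:R < h < p%:R + 2) ->
    (if odd q.+1 then h == q.+1%:R else q%:R < h < q%:R + 2) -> False.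
  move=> ->; rewrite /= negbK -[p.+2]addn2 -[p.+1]addn1 !natrD.
  by case: (odd p) => /= [/andP[? ?] /eqP|/eqP + /andP[? ?]]; lra.
have [lt|lt|//] := ltngtP i l.
  by case: (lev_lt i l) => //; apply/eqP; rewrite eqn_leq -ltnS li lt.
by case: (lev_lt l i) => //; apply/eqP; rewrite eqn_leq -ltnS il lt.
Qed.

Let to_fenceE a t : over a t -> to_fence t = Some a.
Proof.
move=> ha; rewrite /to_fence; case: pickP => [b hb|/(_ a)]; last by rewrite ha.
by rewrite (over_inj ha hb).
Qed.

Let height_le j t : height j t <= m%:R.
Proof.
by rewrite -[leRHS]mulr1 ler_wpM2l// -subr_ge0 opprB addrC subrK mulr_ge0.
Qed.

(** The floor of the height is the level sought, unless it is odd and the height lies strictly above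
    it; then the next even level is, which exists because heights are at most [m]. *)
Let over_ex j t : 1 <= height j t -> exists i, over (j, i) t.
Proof.
move=> h1; set h := height j t in h1.
have hm : h <= m%:R := height_le j t.
have /andP[t1 t2] := truncn_itv (le_trans ler01 h1).
have k0 : (0 < Num.truncn h)%N by rewrite truncn_gt0.
have km : (Num.truncn h <= m)%N by rewrite -(ler_nat R); apply: le_trans hm.
move: t1 t2 k0 km; case: (Num.truncn h) => // k t1 t2 _ km.
have [ok|ek] := boolP (odd k).
  exists (Ordinal km) => /=; rewrite ok /= -/h.
  move: t1 t2; rewrite -[k.+2]addn2 -[k.+1]addn1 !natrD => *.
  by apply/andP; split; lra.
have [he|hne] := eqVneq h k.+1%:R.
  by exists (Ordinal km); rewrite /= ek -/h he eqxx.
have lt : k.+1%:R < h by rewrite lt_neqAle eq_sym hne.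
have km' : (k.+1 < m)%N by rewrite -(ltr_nat R); apply: lt_le_trans hm.
exists (Ordinal km'); rewrite /= ek /= -/h lt (lt_trans t2)//.
by rewrite -[k.+2]addn2 -[k.+1]addn1 !natrD; lra.
Qed.

Let to_fence_None t : to_fence t = None <-> forall j, height j t < 1.
Proof.
split=> [tN j|lt1].
  rewrite ltNge; apply/negP => /over_ex[i] /to_fenceE.
  by rewrite tN.
rewrite /to_fence; case: pickP => // -[j i]; rewrite /over.
have := lt1 j; case: ifP => [_ h1 /eqP h|oi h1 /andP[h _]]; exfalso.
  by move: h1; rewrite h (ltr_nat R _ 1).
have : i%:R < 1%:R :> R by rewrite (lt_trans h).
by rewrite ltr_nat ltnS leqn0 => /eqP i0; rewrite i0 in oi.
Qed.

Let height_continuous j : continuous (height j).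
Proof.
move=> t; apply: cvgM; first exact: cvg_cst.
apply: cvgB; first exact: cvg_cst.
apply: cvgM; first exact: cvg_cst.
apply: cvg_norm; apply: cvgB; last exact: cvg_cst.
by apply: cvgM => //; exact: cvg_cst.
Qed.

(** At a minimal point the condition on the heights is open, so the path is locally constant; near
    an odd level it can only move to an adjacent even level, the root counting as level 0, and these
    lie below. *)
Lemma to_fence_le (t : R) : \forall t' \near t, (to_fence t' <= to_fence t)%O.
Proof.
have near_itv j a b : a < height j t < b ->
    \forall t' \near t, a < height j t' < b.
  move=> hab; have hin : height j t \in `]a, b[ by rewrite in_itv.
  have cin : \forall t' \near t, height j t' \in `]a, b[.
    exact: (@height_continuous j t _ (near_in_itvoo hin)).
  by apply: filterS cin => t' /=; rewrite in_itv.
case tt: (to_fence t) => [[j i]|]; last first.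
  move/to_fence_None : tt => lt1.
  have near_lt1 j : \forall t' \near t, height j t' < 1.
    have : (height j t - 1) < height j t < 1 by rewrite lt1 andbT; lra.
    by move=> /near_itv le1; apply: filterS le1 => t' /andP[].
  by apply: filterS (filter_forall _ near_lt1) => t' /to_fence_None->.
have ji : over (j, i) t.
  by move: tt; rewrite /to_fence; case: pickP => // -[k l] + [<- <-].
move: (ji); rewrite /over; case: ifP => [oi /eqP ht|ei]; last first.
  move=> /near_itv near_h; apply: filterS near_h => t' ht'.
  by rewrite (@to_fenceE (j, i)) ?lexx // /over ei.
have /near_itv near_h : i%:R < height j t < i%:R + 2.
  by rewrite ht -[i.+1]addn1 natrD; apply/andP; split; lra.
apply: filterS near_h => t' /andP[hl hr].
have [lt_i|gt|e] := ltgtP (height j t') i.+1%:R; last first.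
- by rewrite (@to_fenceE (j, i)) ?lexx // /over oi e eqxx.
- move: oi => /= oi; have im : (i.+1 < m)%N.
    by rewrite -(ltr_nat R); apply: lt_le_trans gt (height_le _ _).
  rewrite (@to_fenceE (j, Ordinal im)).
    by rewrite /Order.le /= /fence_le /= /same_branch eqxx /= oi eqxx !orbT.
  rewrite /= ifN ?negbK // gt /= (lt_le_trans hr) // -[i.+1]addn1 natrD; lra.
- case: i {tt} ji oi ht hl hr lt_i => -[|p] pm ji oi ht hl hr lt_i.
    (* Just under level 1 the path is at the root: branch [j] still has positive height, so no other
       branch can reach level 1. *)
    suff -> : to_fence t' = None by [].
    apply/to_fence_None => k; have [h1|//] := leP 1 (height k t').
    have k0 : 0 < height k t' by lra.
    rewrite -(height_inj hl k0) in h1.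
    by have := le_lt_trans h1 lt_i; rewrite (ltr_nat R 1 1).
  move: oi => /= oi; rewrite (@to_fenceE (j, Ordinal (ltnW pm))).
    by rewrite /Order.le /= /fence_le /= /same_branch eqxx /= oi eqxx orbT.
  rewrite /= ifN //; apply/andP; split; last by rewrite -natrD addn2.
  by move: hl; apply: le_lt_trans; rewrite ler_nat.
Unshelve. all: by end_near. Qed.

Lemma to_fence_node (j : 'I_n) (i : 'I_m) :
  (1 < n)%N -> i.+1 = m -> to_fence (j%:R / n.-1%:R) = Some (j, i).
Proof.
move=> n1 im; apply: to_fenceE; rewrite /over.
have -> : height j (j%:R / n.-1%:R) = i.+1%:R.
  rewrite /height divfK ?pnatr_eq0 -?lt0n -?subn1 ?subn_gt0//.
  by rewrite subrr normr0 mulr0 subr0 mulr1 im.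
by case: ifP => // _; rewrite -[i.+1]addn1 natrD; apply/andP; split; lra.
Qed.

End FencePath.

(** * Specialization under maps, powers and subspaces *)

Lemma spec_le_comp (S T : topologicalType) (f : S -> T) x y :
  continuous f -> spec_le x y -> spec_le (f x) (f y).
Proof.
move=> cf /spec_leP xy; apply/spec_leP => O oO Ofy.
by apply: (xy (f @^-1` O)) => //; move/continuousP : cf; exact.
Qed.

Lemma spec_le_power (n : nat) (P : topologicalType) (x y : power P n) :
  (forall j, spec_le (x j) (y j)) -> spec_le x y.
Proof.
move=> xy; apply/spec_leP => O oO Oy.
(* Convergence of the principal filter at [x] can be tested coordinatewise. *)
suff : globally [set x] --> y.
  by move/(_ O (open_nbhs_nbhs (conj oO Oy))); apply.
apply/cvg_sup => j A; rewrite nbhsE => -[_ [[V oV <-] Vy] VA] _ ->.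
by apply: VA => /=; move/spec_leP: (xy j); exact.
Qed.

Lemma spec_le_set_val (T : topologicalType) (U : set T) (x y : U) :
  spec_le (set_val x) (set_val y) -> spec_le x y.
Proof.
by move/spec_leP => xy; apply/spec_leP => _ [V oV <-] /=; exact: xy.
Qed.

Lemma near_spec_le_power (n : nat) (P : topologicalType) (U : set (power P n))
    (x : U) : finite_set [set: P] ->
  \forall x' \near x, forall j, spec_le (set_val x' j) (set_val x j).
Proof.
move=> Pfin.
apply: (@filter_forall U 'I_n
  (fun j => [set x' : U | spec_le (set_val x' j) (set_val x j)]) (nbhs x)) => j.
have cj : continuous (proj j \o set_val : U -> P).
  move=> z; apply: (@continuous_comp U (power P n) P set_val (proj j) z).
    exact: initial_continuous.
  exact: proj_continuous.
exact: (cj x _ (near_spec_le (set_val x j) Pfin)).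
Qed.

(** * From combinatorial to topological sections *)

Section MonotoneToLocal.
Variables (R : realType) (n m : nat) (P : topologicalType).
Hypothesis Pfin : finite_set [set: P].
Variables (U : set (power P n)) (s : U -> fence_maps n m.+1 P).
Hypothesis s_mono : forall x y : U,
  (forall j, spec_le (set_val x j) (set_val y j)) ->
  forall a, spec_le (set_val (s x) a) (set_val (s y) a).

Definition path_of_fence (x : U) (t : unit_interval R) : P :=
  set_val (s x) (to_fence n m.+1 (set_val t)).

Lemma path_of_fence_continuous x : continuous (path_of_fence x).
Proof.
apply: spec_le_continuous => t.
have ct : continuous (set_val : unit_interval R -> R).
  exact: (@initial_continuous (set_type `[0%R : R, 1%R]) R set_val).
have near_t : \forall t' \near t,
    (to_fence n m.+1 (set_val t') <= to_fence n m.+1 (set_val t))%O.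
  exact: (ct t _ (to_fence_le n m.+1 (set_val t))).
apply: filterS near_t => t' /=.
by have /set_mem := valP (s x); apply.
Qed.

Definition path_of_fence_cts (x : U) : path_space R P :=
  mkcts (@path_of_fence_continuous x).

(** Points near [x] lie coordinatewise below [x], so their paths lie pointwise below that of [x] and
    map [K] into every open set into which it does. *)
Lemma path_of_fence_cts_continuous : continuous path_of_fence_cts.
Proof.
apply: continuous_comp_initial => x.
have FF : Filter (nbhs (x : U)) := nbhs_filter x.
pose F : set_system {compact-open, unit_interval R -> P} :=
  path_of_fence @ nbhs x.
suff : F --> (path_of_fence x : {compact-open, unit_interval R -> P}) by [].
apply: (iffRL (compact_open_cvgP _ (fmap_filter _ FF))) => K O _ oO xKO.
have near_x : \forall x' \near (x : U), path_of_fence x' @` K `<=` O.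
  apply: filterS (near_spec_le_power x Pfin) => x' x'x _ [t Kt <-].
  have /spec_leP : spec_le (path_of_fence x' t) (path_of_fence x t).
    exact: s_mono.
  by apply => //; apply: xKO; exists t.
exact: near_x.
Qed.

End MonotoneToLocal.

Lemma monotone_section_local (R : realType) (n m : nat) (P : topologicalType)
    (U : set (power P n)) :
  finite_set [set: P] -> (1 < n)%N -> has_monotone_section m.+1 U ->
  has_local_section (@path_eval R P n) U.
Proof.
move=> Pfin n1 [s s_mono sx]; exists (path_of_fence_cts R s).
  exact: path_of_fence_cts_continuous.
move=> x; apply/funext => j; rewrite -[in RHS]sx /fence_eval.
congr (set_val (s x) _); exact: to_fence_node.
Qed.

(** * From topological to combinatorial sections *)

Section LocalToMonotone.
Variables (R : realType) (n : nat) (P : topologicalType).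
Hypothesis Pfin : finite_set [set: P].
Variables (U : set (power P n)) (s : U -> path_space R P).
Hypothesis s_cont : continuous s.

Definition track (x : U) (t : unit_interval R) : P :=
  (s x : continuousType (unit_interval R) P) t.

(** Continuity makes [s] monotone for specialization; evaluation at [t] respects this, since sending
    the compact set [[set t]] into an open set is an open condition on paths. *)
Lemma track_mono (x y : U) t :
  (forall j, spec_le (set_val x j) (set_val y j)) ->
  spec_le (track x t) (track y t).
Proof.
move=> xy; have /spec_leP sxy : spec_le (s x) (s y).
  have xyU : spec_le x y.
    apply: spec_le_set_val.
    by have := spec_le_power xy; exact.
  exact: (spec_le_comp s_cont xyU).
apply/spec_leP => O oO Oyt.
pose through := [set a : path_space R P |
  ((a : continuousType _ _) : unit_interval R -> P) @` [set t] `<=` O].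
suff : through (s x) by apply; exists t.
apply: (sxy through); last by move=> _ [_ -> <-].
exists [set g | g @` [set t] `<=` O] => //.
by apply: compact_open_open => //; exact: compact_set1.
Qed.

Lemma near_track (t : unit_interval R) :
  \forall t' \near t, forall x, spec_le (track x t') (track x t).
Proof.
have [e Pe] : exists e : seq P, forall x, x \in e.
  have /finite_seqP[e eP] := Pfin; exists e => x.
  by have : [set: P] x by []; rewrite eP.
(* With the power of [P] enumerated by a finite type, one neighbourhood of [t] per point can be
   chosen and all of them intersected. *)
pose code (f : {ffun 'I_n -> 'I_(size e)}) : power P n :=
  fun j => tnth (in_tuple e) (f j).
have code_surj z : exists f, code f = z.
  have /= /choice[f zf] j : exists i, z j = tnth (in_tuple e) i.
    by apply/tnthP; exact: Pe.
  by exists (finfun f); apply/funext => j; rewrite /code ffunE -zf.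
have near_code f : \forall t' \near t,
    forall x, set_val x = code f -> spec_le (track x t') (track x t).
  have [[x xf]|nx] := pselect (exists x : U, set_val x = code f); last first.
    by near=> t' => x xf; case: nx; exists x.
  have near_x : \forall t' \near t, spec_le (track x t') (track x t).
    have ct : continuous (track x) := @cts_fun _ _ (s x).
    exact: (ct t _ (near_spec_le _ Pfin)).
  apply: filterS near_x => t' xt y yf.
  by have -> : y = x by apply: val_inj; rewrite /= [LHS]yf.
apply: filterS (filter_forall _ near_code) => t' xt x.
by have [f fx] := code_surj (set_val x); apply: xt (esym fx).
Unshelve. all: by end_near. Qed.

End LocalToMonotone.

(** A Lebesgue number argument, stated for all large [M] so that finitely many sections can later
    share one [M]. *)
Lemma uniform_subdivision (R : realType)
    (Q : unit_interval R -> unit_interval R -> Prop) :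
  (forall u, \forall t \near u, Q t u) ->
  \forall M \near \oo, forall r : unit_interval R, exists u, forall t,
    `|set_val t - set_val r| * M%:R <= 1 -> Q t u.
Proof.
move=> Qnear.
pose S M (r : R) := exists u, forall t, `|set_val t - r| * M%:R <= 1 -> Q t u.
suff : \forall M \near \oo, `[0%R : R, 1%R]%classic `<=` S M.
  apply: filterS => M SM r; apply: (SM (set_val r)).
  by have /set_mem := valP r.
have := @segment_compact R 0 1; move/compact_near_coveringP; apply => r r01.
pose u : unit_interval R := exist _ r (mem_set r01).
have [e e0 eQ] : exists2 e : R, 0 < e & forall t, `|set_val t - r| < e -> Q t u.
  have := Qnear u; rewrite /prop_near1 nbhsE => -[_ [[V oV <-] Vu] VQ].
  have /nbhs_ballP[e /= e0 eV] := open_nbhs_nbhs (conj oV Vu).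
  by exists e => // t tr; apply: VQ; apply: eV; rewrite /ball /= distrC.
(* One half of [e] bounds the distance from [r] to [r'], the other that from [r'] to [t]. *)
exists (ball r (e / 2), [set M | 2 / e < M%:R]).
  by split; [apply: nbhsx_ballx; rewrite divr_gt0|exact: nbhs_infty_gtr].
move=> [r' M] /= [rr' eM]; exists u => t tr'; apply: eQ.
have M0 : 0 < M%:R :> R by apply: lt_trans eM; rewrite divr_gt0.
have : `|set_val t - r'| < e / 2.
  rewrite -(ltr_pM2r M0); apply: le_lt_trans tr' _.
  by move: eM; rewrite ltr_pdivrMr// mulrAC ltr_pdivlMr// mul1r mulrC.
move: rr'; rewrite /ball /= distrC => rr' tr.
have -> : set_val t - r = (set_val t - r') + (r' - r) by lra.
by apply: le_lt_trans (ler_normD _ _) _; lra.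
Qed.

(** All branches follow one sequence, hence agree at the root; the cut-off [K j] lets branches of
    equal length end at different terms. *)
Definition zigzag (T : Type) (n m : nat) (z : nat -> T) (K : 'I_n -> nat)
    (a : fence n m) : T :=
  if a is Some (j, i) then z (minn i.+1 (K j)) else z 0%N.

Lemma zigzag_end (T : Type) (n m : nat) (z : nat -> T) (K : 'I_n -> nat) j :
  zigzag z K (fence_end m j) = z (minn m (K j)).
Proof. by case: m => [|m] //; rewrite min0n. Qed.

(** Odd terms of [z] are peaks, matching the maximal odd levels of the fence; beyond [K j] a branch
    is constant. *)
Lemma zigzag_mono (P : topologicalType) (n m N : nat) (z : nat -> P)
    (K : 'I_n -> nat) :
  (forall j, (K j <= N.*2)%N) ->
  (forall k, (k < N)%N ->
     spec_le (z k.*2) (z k.*2.+1) /\ spec_le (z k.*2.+2) (z k.*2.+1)) ->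
  zigzag z K \in fence_maps n m P.
Proof.
move=> KP zP; apply/mem_set => a b.
have step j p : if odd p then spec_le (z (minn p.+1 (K j))) (z (minn p (K j)))
                else spec_le (z (minn p (K j))) (z (minn p.+1 (K j))).
  have KN := KP j; have [pK|Kp] := ltnP p (K j); last first.
    by rewrite (minn_idPr (leqW Kp)) if_same.
  have pN : (p./2 < N)%N.
    rewrite -ltn_double; apply: leq_ltn_trans (leq_trans pK KN).
    by rewrite -[leqRHS]odd_double_half leq_addl.
  rewrite (minn_idPl pK).
  move: (odd p) (p./2) pN (odd_double_half p) => o h /zP[le1 le2] <-.
  by case: o.
have adj j p q : ~~ odd p -> (q == p.+1) || (p == q.+1) ->
    spec_le (z (minn p (K j))) (z (minn q (K j))).
  move=> ep /orP[/eqP->|/eqP pq]; first by have := step j p; rewrite ifN.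
  by have := step j q; move: ep; rewrite pq /= negbK => ->.
move=> /orP[/eqP->//|/and3P[]].
case: a b => [[j i]|] [[k l]|] //=; rewrite /same_branch.
- by move=> /eqP<-; exact: (adj j i.+1 l.+1).
- by case: i => -[].
- by move=> _; have := adj k 0 l.+1; rewrite min0n; apply.
Qed.

(** With [n.-1 * M] intervals every node is a subdivision time; each interval costs two zigzag
    steps, up to a peak and down again. *)
Lemma local_section_monotone (R : realType) (n : nat) (P : topologicalType)
    (U : set (power P n)) :
  finite_set [set: P] -> (1 < n)%N ->
  has_local_section (@path_eval R P n) U ->
  \forall M \near \oo, has_monotone_section (n.-1 * M).*2 U.
Proof.
move=> Pfin n1 [s s_cont sx].
have sub := uniform_subdivision (near_track Pfin s).
near=> M; set N := (n.-1 * M)%N.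
have M0 : (0 < M)%N by near: M; exact: nbhs_infty_gt.
have n0 : (0 < n.-1)%N by rewrite -subn1 subn_gt0.
have N0 : (0 < N)%N by rewrite muln_gt0 n0.
pose time k : unit_interval R := node R (inord k : 'I_N.+1).
have timeE k : (k <= N)%N -> set_val (time k) = k%:R / N%:R :> R.
  by move=> kN; rewrite /set_val /= inordK.
(* The reach 1/[M] of [tau k] includes the next subdivision time, which is only 1/[N] away. *)
have /= [tau tauP] : exists tau : nat -> unit_interval R, forall k t,
    `|set_val t - set_val (time k)| * M%:R <= 1 ->
    forall x, spec_le (track s x t) (track s x (tau k)).
  suff /choice[tau tauP] : forall k, exists u, forall t,
      `|set_val t - set_val (time k)| * M%:R <= 1 ->
      forall x, spec_le (track s x t) (track s x u).
    by exists tau.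
  by move=> k; move: (time k); near: M.
pose z x p := track s x (if odd p then tau p./2 else time p./2).
(* Node [j] is subdivision time [j * M], placed at twice that index in [z]. *)
pose K (j : 'I_n) := (j * M).*2.
have KN j : (K j <= N.*2)%N.
  by rewrite leq_double leq_mul2r -ltnS prednK ?ltn_ord ?orbT // ltnW.
have zP x k : (k < N)%N ->
    spec_le (z x k.*2) (z x k.*2.+1) /\ spec_le (z x k.*2.+2) (z x k.*2.+1).
  move=> kN; rewrite /z /= negbK odd_double /= uphalf_double doubleK.
  split; apply: tauP; first by rewrite subrr normr0 mul0r.
  rewrite !timeE ?(ltnW kN) // -mulrBl -natrB // subSnn mul1r.
  rewrite ger0_norm ?invr_ge0 ?ler0n // mulrC ler_pdivrMr ?ltr0n // mul1r.
  by rewrite ler_nat leq_pmull.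
exists (fun x => exist (fun g => g \in fence_maps n N.*2 P) _
                   (zigzag_mono N.*2 KN (zP x))).
  (* The times do not depend on [x], so paths are compared at equal times. *)
  move=> x y xy [[j i]|]; exact: track_mono.
move=> x; apply/funext => j; rewrite -[in RHS]sx.
transitivity (zigzag (z x) K (fence_end N.*2 j)) => //; rewrite zigzag_end.
rewrite (minn_idPr (KN j)) /z /K odd_double doubleK /path_eval /track.
congr (Continuous.sort _ _); apply: val_inj; rewrite [LHS]timeE; last first.
  by have := KN j; rewrite leq_double.
by rewrite /= natrM /N natrM -mulf_div divff ?mulr1 // pnatr_eq0 -lt0n.
Unshelve. all: by end_near. Qed.

(** * Equality of the two invariants *)

Theorem theoremB (R : realType) (P : topologicalType)
    (P_finite : finite_set [set: P])
    (P_T0 : kolmogorov_space P)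
    (P_connected : connected [set: P])
    (n : nat) (n_ge2 : (2 <= n)%N) :
  CC R n P = TC R n P.
Proof.
apply/eqP; rewrite eq_le; apply/andP; split.
- apply: le_ereal_inf_tmp => _ [r [r0 [U [Uo Ucov Usec]]] <-].
  have near_M i := local_section_monotone P_finite n_ge2 (Usec i).
  (* The cover is finite, so one [M] serves all its members. *)
  have [M [M0 mono]] : exists M, (0 < M)%N /\
      forall i, has_monotone_section (n.-1 * M).*2 (U i).
    near \oo => M; exists M; split; first by near: M; exact: nbhs_infty_gt.
    by near: M; exact: filter_forall.
  apply: (@le_trans _ _ (CCm R n (n.-1 * M).*2 P)).
    apply: ereal_inf_lbound; exists (n.-1 * M).*2 => //=.
    by rewrite double_gt0 muln_gt0 M0 -subn1 subn_gt0 n_ge2.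
  by apply: ereal_inf_lbound; exists r => //; split=> //; exists U.
- apply: le_ereal_inf_tmp => _ [[//|m] _ <-].
  apply: le_ereal_inf_tmp => _ [r [r0 [U [Uo Ucov Usec]]] <-].
  apply: ereal_inf_lbound; exists r => //; split=> //; exists U; split=> // i.
  exact: monotone_section_local (Usec i).
Unshelve. all: by end_near. Qed.
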